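(* Let $(X,d)$ be a metric space and $(\phi_n)$ a sequence of functions $\phi_n:X\times X\to\mathbb{R}_+$. Let $\phi,\psi:X\times X\to\mathbb{R}_+$ be such that $\phi_n\nearrow\phi$ uniformly with a rate of convergence $\pi$ and such that $\psi\preceq^A\phi_n$ for all $n$ for some $A:\mathbb{N}\to\mathbb{N}$, where $\psi$ is uniformly weakly triangular with modulus $\theta:\mathbb{N}\to\mathbb{N}$. Assume that $X$ has a modulus of total $\phi$-boundedness $\gamma$, that $\alpha_G$ is a $G$-modulus for $G$, that $\beta_H$ is an $H$-modulus for $H$, and that $f:\mathbb{N}\to\mathbb{N}$ is nondecreasing with $f(n)\leq n$. Let $(x_n)\subseteq X$ be a sequence and let (1) $\chi$ be a modulus of uniform $(\phi_{2n})$-$(G,H)$-quasi-Fej\'er monotonicity w.r.t. $F$ and $(AF_k)$ for $(x_{2n})$ with errors $(\varepsilon_n)$, (2) $\xi$ be a Cauchy rate for $\sum\varepsilon_n<\infty$, (3) $\Phi$ be a $\liminf$-bound w.r.t. $F$ and $(AF_k)$ for $(x_{2f(n)})_n$, (4) $\kappa$ be a rate of divergence for $f$, (5) $\zeta$ be a modulus of uniform $(\phi_n)$-$(G,H)$-quasi-$f$-monotonicity w.r.t. $F$ and $(AF_k)$ for $(x_n)$ with errors $(\varepsilon_n)$. Assume moreover that $F$ is uniformly $\psi$-closed with moduli $\delta,\omega:\mathbb{N}\to\mathbb{N}$ (w.r.t. $(AF_k)$). For $k\in\mathbb{N}$ put $\tilde\theta(k)=\max\{\theta(k),\omega(k)\}$,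 $b_k=\beta_H(A(\tilde\theta(k)))$, $r_k=4b_k+3$, $s_k=\beta_H(\alpha_G(r_k))$, $K_k=\max\{2\alpha_G(r_k)+1,\,2\alpha_G(2s_k+1)+1\}$, $P=\gamma(K_k)$ and $$\hat k=\max\{\kappa(\xi(4s_k+3)),\ \xi(2b_k+1),\ \kappa(\xi(2b_k+1)),\ \kappa(\pi(K_k))\}.$$ For $g:\mathbb{N}\to\mathbb{N}$ put $$\tilde\eta_{k,\delta}(n,r)=\max\Big\{\delta(k),\ \chi\big(n,\lfloor g(2n)/2\rfloor,r\big),\ \zeta\big(n,\lfloor g(2n)/2\rfloor,r\big),\ \chi\big(f(n),n-f(n),4\beta_H(\alpha_G(r))+3\big)\Big\},$$ $\tilde\eta^M_{k,\delta}(n,r)=\max\{\tilde\eta_{k,\delta}(i,r)\mid i\leq n\}$, and $\tilde\Psi_0(0,k,g)=0$, $\tilde\Psi_0(n+1,k,g)=\Phi(\tilde\eta^M_{k,\delta}(\tilde\Psi_0(n,k,g),r_k),\hat k)$. Let $\tilde\Psi(k,g)=2\tilde\Psi_0(P,k,g)$. Then for all $k\in\mathbb{N}$ and all $g:\mathbb{N}\to\mathbb{N}$: $$\exists N\leq\tilde\Psi(k,g)\ \forall i,j\in[N;N+g(N)]\ \Big(\psi(x_i,x_j)\leq\tfrac{1}{k+1}\text{ and }x_i\in AF_k\Big).$$ If $\psi$ is instead uniformly triangular with a modulus $\theta$, then for all $k\in\mathbb{N}$ and all $g:\mathbb{N}\to\mathbb{N}$, with the same $\tilde\Psi$: $$\exists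 N\leq\tilde\Psi(k,g)\ \forall i,j\in[N;N+g(N)]\ \Big(d(x_i,x_j)\leq\tfrac{1}{k+1}\text{ and }x_i\in AF_k\Big).$$
   Context: $\mathbb{N}=\{0,1,2,\dots\}$, $\mathbb{R}_+=[0,\infty)$, $[a;b]=\{a,a+1,\dots,b\}$ for $a\le b$ in $\mathbb{N}$. Throughout, $G,H:\mathbb{R}_+\to\mathbb{R}_+$; $F\subseteq X$ is nonempty and $F=\bigcap_{k}AF_k$ for sets $AF_k\subseteq X$ with $AF_k\supseteq AF_{k+1}$; $(\varepsilon_n)\subseteq\mathbb{R}_+$ with $\sum\varepsilon_n<\infty$. All moduli are functions with natural number arguments and values. - $\pi$ is a rate of convergence for $\phi_n\nearrow\phi$ uniformly: $\forall k\,\forall n\geq\pi(k)\,\forall x,y\in X\ (\phi_n(x,y)\leq\phi(x,y)+\frac1{k+1})$. - $\psi\preceq^A\phi$: $\phi(x,y)\leq\frac1{A(k)+1}\to\psi(x,y)\leq\frac1{k+1}$ for all $k\in\mathbb{N}$, $x,y\in X$. - $\psi$ is uniformly weakly triangular with modulus $\theta$: for all $k$, $x,y,z$: $\psi(y,x),\psi(y,z)\leq\frac1{\theta(k)+1}\to\psi(x,z)\leq\frac1{k+1}$. It is uniformly triangular with modulus $\theta$ if under the same premise $d(x,z)\leq\frac1{k+1}$. - $\gamma$ is a modulus of total $\phi$-boundedness for $X$: for all $k$ and all sequences $(y_n)\subseteq X$ there are $0\leq i<j\leq\gamma(k)$ with $\phi(y_j,y_i)\leq\frac1{k+1}$. -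 $F$ is uniformly $\psi$-closed with moduli $\delta,\omega$: for all $k$ and $p,q\in X$: $q\in AF_{\delta(k)}$ and $\psi(q,p)\leq\frac1{\omega(k)+1}$ imply $p\in AF_k$. - $G$-modulus $\alpha_G$: $a\leq\frac1{\alpha_G(k)+1}\to G(a)\leq\frac1{k+1}$; $H$-modulus $\beta_H$: $H(a)\leq\frac1{\beta_H(k)+1}\to a\leq\frac1{k+1}$ (all $k\in\mathbb{N}$, $a\in\mathbb{R}_+$). - $\chi$ is a modulus of uniform $(\phi_n)$-$(G,H)$-quasi-Fej\'er monotonicity w.r.t. $F$ and $(AF_k)$ for $(y_n)$ with errors $(\varepsilon_n)$: for all $n,m,r\in\mathbb{N}$, all $p\in AF_{\chi(n,m,r)}$ and all $l\leq m$: $H(\phi_{n+l}(p,y_{n+l}))<G(\phi_n(p,y_n))+\sum_{i=n}^{n+l-1}\varepsilon_i+\frac1{r+1}$. (In (1): $y_n=x_{2n}$ and distances $\phi_{2n}$.) - $\zeta$ is a modulus of uniform $(\phi_n)$-$(G,H)$-quasi-$f$-monotonicity w.r.t. $F$ and $(AF_k)$ for $(x_n)$ with errors $(\varepsilon_n)$: for all $n,m,r$, all $p\in AF_{\zeta(n,m,r)}$ and all $l\leq m$: $H(\phi_{2(n+l)+1}(p,x_{2(n+l)+1}))<G(\phi_{2f(n)}(p,x_{2f(n)}))+\sum_{i=f(n)}^{n+l}\varepsilon_i+\frac1{r+1}$. - Cauchy rate $\xi$: $\sum_{i=\xi(k)}^\infty\varepsilon_i\leq\frac1{k+1}$ for all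 $k$. - $\Phi$ is a $\liminf$-bound w.r.t. $F$ and $(AF_k)$ for $(y_n)$: $\forall k,n\,\exists N\in[n;\Phi(k,n)]\,(y_N\in AF_k)$; $\Phi$ is always assumed nondecreasing in both arguments. - $\kappa$ is a rate of divergence for $f$: $\forall L\,\forall n\geq\kappa(L)\,(f(n)\geq L)$. *)

(* Defs.v *)
From HB Require Import structures.
From mathcomp Require Import all_boot all_order all_algebra.
From mathcomp Require Import boolp classical_sets interval_inference reals ereal.
From mathcomp Require Import topology normedtype sequences.

Set Implicit Arguments.
Unset Strict Implicit.
Unset Printing Implicit Defensive.

Import Order.TTheory GRing.Theory Num.Theory.

Local Open Scope classical_set_scope.
Local Open Scope ring_scope.

(* Functions with values in R_+ are {nonneg R}-valued; the metric of
   X : metricType R is mdist. *)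

(* Rate for the uniform convergence of (phi_n) up to phi, read as this one-sided
   estimate only: neither phi_n <= phi nor monotonicity in n is required. *)
Definition upper_rate (R : realType) (X : Type)
    (phin : nat -> X -> X -> {nonneg R}) (phi : X -> X -> {nonneg R})
    (rate : nat -> nat) : Prop :=
  forall k n, (rate k <= n)%N -> forall x y : X,
    (phin n x y)%:num <= (phi x y)%:num + k.+1%:R^-1.

Definition preceq_modulus (R : realType) (X : Type)
    (A : nat -> nat) (psi phi : X -> X -> {nonneg R}) : Prop :=
  forall k (x y : X),
    (phi x y)%:num <= (A k).+1%:R^-1 -> (psi x y)%:num <= k.+1%:R^-1.

Definition weakly_triangular (R : realType) (X : Type)
    (psi : X -> X -> {nonneg R}) (theta : nat -> nat) : Prop :=
  forall k (x y z : X),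
    (psi y x)%:num <= (theta k).+1%:R^-1 ->
    (psi y z)%:num <= (theta k).+1%:R^-1 ->
    (psi x z)%:num <= k.+1%:R^-1.

Definition triangular (R : realType) (X : metricType R)
    (psi : X -> X -> {nonneg R}) (theta : nat -> nat) : Prop :=
  forall k (x y z : X),
    (psi y x)%:num <= (theta k).+1%:R^-1 ->
    (psi y z)%:num <= (theta k).+1%:R^-1 ->
    mdist x z <= k.+1%:R^-1.

Definition total_boundedness_modulus (R : realType) (X : Type)
    (phi : X -> X -> {nonneg R}) (gamma : nat -> nat) : Prop :=
  forall k (y : nat -> X), exists i j : nat,
    (i < j <= gamma k)%N /\ (phi (y j) (y i))%:num <= k.+1%:R^-1.

Definition uniformly_closed (R : realType) (X : Type)
    (AF : nat -> set X) (psi : X -> X -> {nonneg R})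
    (delta omega : nat -> nat) : Prop :=
  forall k (p q : X),
    AF (delta k) q -> (psi q p)%:num <= (omega k).+1%:R^-1 -> AF k p.

Definition G_modulus (R : realType) (G : {nonneg R} -> {nonneg R})
    (alphaG : nat -> nat) : Prop :=
  forall k (a : {nonneg R}),
    a%:num <= (alphaG k).+1%:R^-1 -> (G a)%:num <= k.+1%:R^-1.

Definition H_modulus (R : realType) (H : {nonneg R} -> {nonneg R})
    (betaH : nat -> nat) : Prop :=
  forall k (a : {nonneg R}),
    (H a)%:num <= (betaH k).+1%:R^-1 -> a%:num <= k.+1%:R^-1.

Definition quasi_fejer (R : realType) (X : Type)
    (phin : nat -> X -> X -> {nonneg R}) (G H : {nonneg R} -> {nonneg R})
    (AF : nat -> set X) (y : nat -> X) (eps : nat -> {nonneg R})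
    (chi : nat -> nat -> nat -> nat) : Prop :=
  forall (n m r : nat) (p : X), AF (chi n m r) p ->
  forall l : nat, (l <= m)%N ->
    (H (phin (n + l)%N p (y (n + l)%N)))%:num
      < (G (phin n p (y n)))%:num
        + \sum_(n <= i < n + l) (eps i)%:num + r.+1%:R^-1.

Definition quasi_f_monotone (R : realType) (X : Type)
    (phin : nat -> X -> X -> {nonneg R}) (G H : {nonneg R} -> {nonneg R})
    (f : nat -> nat)
    (AF : nat -> set X) (x : nat -> X) (eps : nat -> {nonneg R})
    (zeta : nat -> nat -> nat -> nat) : Prop :=
  forall (n m r : nat) (p : X), AF (zeta n m r) p ->
  forall l : nat, (l <= m)%N ->
    (H (phin (2 * (n + l) + 1)%N p (x (2 * (n + l) + 1)%N)))%:num
      < (G (phin (2 * f n)%N p (x (2 * f n)%N)))%:num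
        + \sum_(f n <= i < (n + l).+1) (eps i)%:num + r.+1%:R^-1.

Definition summable_errors (R : realType) (eps : nat -> {nonneg R}) : Prop :=
  (\sum_(0 <= i <oo) (eps i)%:num%:E < +oo)%E.

Definition cauchy_rate (R : realType) (eps : nat -> {nonneg R})
    (xi : nat -> nat) : Prop :=
  forall k, (\sum_(xi k <= i <oo) (eps i)%:num%:E <= (k.+1%:R^-1)%:E)%E.

Definition liminf_bound (X : Type) (AF : nat -> set X) (y : nat -> X)
    (Phi : nat -> nat -> nat) : Prop :=
  (forall k n, exists N : nat, (n <= N <= Phi k n)%N /\ AF k (y N)) /\
  (forall k k' n n', (k <= k')%N -> (n <= n')%N -> (Phi k n <= Phi k' n')%N).

Definition divergence_rate (f : nat -> nat) (kappa : nat -> nat) : Prop :=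
  forall L n, (kappa L <= n)%N -> (L <= f n)%N.

Section Rate.
Local Open Scope nat_scope.
Variables (A theta omega alphaG betaH gamma rate xi kappa delta f : nat -> nat).
Variables (chi zeta : nat -> nat -> nat -> nat) (Phi : nat -> nat -> nat).

Definition theta_max (k : nat) : nat := maxn (theta k) (omega k).

Definition b_ (k : nat) : nat := betaH (A (theta_max k)).

Definition r_ (k : nat) : nat := 4 * b_ k + 3.

Definition s_ (k : nat) : nat := betaH (alphaG (r_ k)).

Definition K_ (k : nat) : nat :=
  maxn (2 * alphaG (r_ k) + 1) (2 * alphaG (2 * s_ k + 1) + 1).

Definition P_ (k : nat) : nat := gamma (K_ k).

Definition k_hat (k : nat) : nat :=
  maxn (kappa (xi (4 * s_ k + 3)))
    (maxn (xi (2 * b_ k + 1))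
      (maxn (kappa (xi (2 * b_ k + 1))) (kappa (rate (K_ k))))).

Definition eta (k : nat) (g : nat -> nat) (n r : nat) : nat :=
  maxn (delta k)
    (maxn (chi n (g (2 * n) %/ 2) r)
      (maxn (zeta n (g (2 * n) %/ 2) r)
        (chi (f n) (n - f n) (4 * betaH (alphaG r) + 3)))).

Definition etaM (k : nat) (g : nat -> nat) (n r : nat) : nat :=
  \max_(i < n.+1) eta k g i r.

Fixpoint Psi0 (n k : nat) (g : nat -> nat) : nat :=
  if n is n'.+1 then Phi (etaM k g (Psi0 n' k g) (r_ k)) (k_hat k) else 0.

Definition Psi (k : nat) (g : nat -> nat) : nat := 2 * Psi0 (P_ k) k g.

End Rate.

(* Main.v *)
Require Import Defs.
From HB Require Import structures.
From mathcomp Require Import all_boot all_order all_algebra.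
From mathcomp Require Import boolp classical_sets interval_inference reals ereal.
From mathcomp Require Import topology normedtype sequences.
From mathcomp Require Import zify lra.

(** The total boundedness modulus, applied to finitely many liminf points
    [y_0, ..., y_P] with [y_j = x_(2 f(N_j))], yields two of them that are
    [phi]-close, an earlier [y_i] and a later [y_j].  The recursion behind the
    rate makes [y_j] such a good approximate point of [F] that all the
    monotonicity assumptions may be used with [p = y_j] and starting times up
    to a bound for [N_i] ([phi_close_approximate_point]).

    Put [n = N_i].  Smallness of the distance from [p] then travels along [x]
    in two legs ([closeness_propagates]): the Fejer property carries it from
    time [2 f(n)] to time [2 n], and from there the Fejer property and the
    [f]-monotonicity carry it to all even and odd times in
    [[2 n; 2 n + g(2 n)]].  The second leg at odd times starts again from
    [2 f(n)], so the closeness found at the outset has to meet the precision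
    required for it as well as the one required for the first leg, which is why
    [K_] is a maximum.

    So every [x_i] of the window [[2 n; 2 n + g(2 n)]] is [psi]-close to the
    single point [p]; (weak) triangularity compares any two of them, and uniform
    closedness transfers the approximate membership of [p] to them. *)

Set Implicit Arguments.
Unset Strict Implicit.
Unset Printing Implicit Defensive.

Import Order.TTheory GRing.Theory Num.Theory.

Local Open Scope classical_set_scope.
Local Open Scope ring_scope.

Lemma ler_invS (R : numFieldType) (m n : nat) :
  (m <= n)%N -> n.+1%:R^-1 <= m.+1%:R^-1 :> R.
Proof. by move=> mn; rewrite lef_pV2 ?posrE ?ltr0n// ler_nat ltnS. Qed.

Lemma invS_half (R : numFieldType) (n : nat) :
  (2 * n + 1).+1%:R^-1 = n.+1%:R^-1 / 2 :> R.
Proof.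
by rewrite (_ : (2 * n + 1).+1 = (n.+1 * 2)%N) ?natrM ?invfM//; lia.
Qed.

Lemma invS_quarter (R : numFieldType) (n : nat) :
  (4 * n + 3).+1%:R^-1 = n.+1%:R^-1 / 4 :> R.
Proof.
by rewrite (_ : (4 * n + 3).+1 = (n.+1 * 4)%N) ?natrM ?invfM//; lia.
Qed.

Lemma antitone_approximants (T : Type) (AF : nat -> set T) :
  (forall k, AF k.+1 `<=` AF k) ->
  forall m n, (m <= n)%N -> AF n `<=` AF m.
Proof.
move=> hAF m n /subnK <-; elim: (n - m)%N => [//|d IH].
exact: subset_trans (hAF _) IH.
Qed.

Lemma cauchy_rate_block (R : realType) (eps : nat -> {nonneg R})
    (xi : nat -> nat) (k m n : nat) :
  cauchy_rate eps xi -> (xi k <= m)%N ->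
  \sum_(m <= i < n) (eps i)%:num <= k.+1%:R^-1.
Proof.
move=> hxi km; rewrite -lee_fin -sumEFin; apply: le_trans (hxi k).
have eps0 i : (0 <= (eps i)%:num%:E)%E by rewrite lee_fin.
have [mn|nm] := leqP m n; last first.
  by rewrite big_geq ?(ltnW nm)//; apply: nneseries_ge0.
apply: (le_trans _ (nneseries_lim_ge n _)) => [|? _ _]; last exact: eps0.
rewrite (big_cat_nat km mn)/= leeDr//.
by apply: sume_ge0 => i _; exact: eps0.
Qed.

(** The bound obtained by iterating the recursion [c] times grows with [c];
    this is what lets the later of the two close liminf points, chosen with
    respect to a later bound [N], be good enough for all starting times up to
    the earlier index.  Indices are shifted by one: the [j]-th liminf index is
    bounded by the [j.+1]-st iterate, so that the earlier index, being at most
    [gamma K - 1], stays below the [gamma K]-th iterate. *)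
Lemma phi_close_approximate_point (R : realType) (X : Type)
    (phi : X -> X -> {nonneg R}) (gamma : nat -> nat) (AF : nat -> set X)
    (y : nat -> X) (Phi : nat -> nat -> nat) (e : nat -> nat) (c K : nat) :
  total_boundedness_modulus phi gamma ->
  (forall k, AF k.+1 `<=` AF k) ->
  liminf_bound AF y Phi ->
  exists n (p : X),
    [/\ (c <= n)%N,
        (n <= iter (gamma K) (fun N => Phi (\max_(i < N.+1) e i) c) 0)%N,
        AF (e n) p & (phi p (y n))%:num <= K.+1%:R^-1].
Proof.
move=> hgamma hAF [hPhi Phi_mono].
set step := fun N => Phi _ c; pose B j := iter j step 0%N.
have step_mono m n : (m <= n)%N -> (step m <= step n)%N.
  move=> mn; apply: Phi_mono => //; apply/bigmax_leqP => i _.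
  have im : (i < n.+1)%N by apply: leq_trans (ltn_ord i) _; rewrite ltnS.
  exact: (leq_bigmax (Ordinal im)).
have BS_mono j : (B j <= B j.+1)%N by elim: j => [//|j IH]; exact: step_mono.
have B_mono i j : (i <= j)%N -> (B i <= B j)%N.
  exact: (homo_leq leqnn leq_trans).
have [N hN] := choice (fun j => hPhi (\max_(i < (B j).+1) e i) c).
have [i [j [/andP[ij jK] close]]] := hgamma K (y \o N).
have [/andP[ci iB] _] := hN i; have [_ yj] := hN j.
have iBj : (N i <= B j)%N by apply: leq_trans iB (B_mono i.+1 j ij).
exists (N i), (y (N j)); split=> //.
  exact: leq_trans iBj (B_mono _ _ jK).
apply: antitone_approximants yj => //.
have Nij : (N i < (B j).+1)%N by rewrite ltnS.
exact: (leq_bigmax (Ordinal Nij)).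
Qed.

Lemma Psi0_iter (A theta omega alphaG betaH rate xi kappa delta f : nat -> nat)
    (chi zeta : nat -> nat -> nat -> nat) (Phi : nat -> nat -> nat)
    (k : nat) (g : nat -> nat) (n : nat) :
  Psi0 A theta omega alphaG betaH rate xi kappa delta f chi zeta Phi n k g
  = iter n (fun N => Phi (\max_(i < N.+1)
        Defs.eta alphaG betaH delta f chi zeta k g i (r_ A theta omega betaH k))
      (k_hat A theta omega alphaG betaH rate xi kappa k)) 0%N.
Proof. by elim: n => [//|n IH] /=; rewrite IH. Qed.

(** The errors of each use of monotonicity are split into a [G]-term, a tail of
    [eps] and the slack of the modulus.  In the first leg they are 1/2, 1/4 and
    1/4 of the precision [(s + 1)^-1] that [betaH] asks for, in the second leg
    1/4, 1/2 and 1/4 of [(b + 1)^-1].  At even times the second leg starts at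
    time [2 n], where the first leg has ended; at odd times it starts at time
    [2 f(n)]. *)
Lemma closeness_propagates (R : realType) (X : Type)
    (phin : nat -> X -> X -> {nonneg R}) (G H : {nonneg R} -> {nonneg R})
    (AF : nat -> set X) (eps : nat -> {nonneg R}) (alphaG betaH f : nat -> nat)
    (x : nat -> X) (chi zeta : nat -> nat -> nat -> nat) (xi : nat -> nat)
    (p : X) (n m c : nat) :
  let b := betaH c in let r := (4 * b + 3)%N in let s := betaH (alphaG r) in
  G_modulus G alphaG -> H_modulus H betaH ->
  quasi_fejer (fun n => phin (2 * n)%N) G H AF (fun n => x (2 * n)%N) eps chi ->
  quasi_f_monotone phin G H f AF x eps zeta ->
  cauchy_rate eps xi ->
  (f n <= n)%N -> (xi (4 * s + 3) <= f n)%N -> (xi (2 * b + 1) <= f n)%N ->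
  AF (chi (f n) (n - f n)%N (4 * s + 3)%N) p ->
  AF (chi n m r) p -> AF (zeta n m r) p ->
  (phin (2 * f n)%N p (x (2 * f n)%N))%:num <= (alphaG r).+1%:R^-1 ->
  (phin (2 * f n)%N p (x (2 * f n)%N))%:num <= (alphaG (2 * s + 1)).+1%:R^-1 ->
  forall i, (2 * n <= i <= 2 * n + m.*2.+1)%N ->
    (phin i p (x i))%:num <= c.+1%:R^-1.
Proof.
move=> b r s hG hH hchi hzeta hxi fn xis xib chis chir zetar close_r close_s i.
have leg1 : (phin (2 * n)%N p (x (2 * n)%N))%:num <= (alphaG r).+1%:R^-1.
  apply: hH; have := hchi _ _ _ _ chis _ (leqnn _).
  rewrite subnKC// => /ltW /le_trans; apply.
  have := hG _ _ close_s; have := cauchy_rate_block n hxi xis.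
  by rewrite invS_half invS_quarter -/s; set z := s.+1%:R^-1; lra.
move=> /andP[ni im].
have [l lm [->|->]] : exists2 l, (l <= m)%N &
    i = (2 * (n + l))%N \/ i = (2 * (n + l) + 1)%N.
- by exists ((i - 2 * n) %/ 2)%N; lia.
- apply: hH; have /ltW/le_trans := hchi _ _ _ _ chir _ lm; apply.
  have := hG _ _ leg1.
  have := cauchy_rate_block (n + l) hxi (leq_trans xib fn).
  by rewrite invS_half invS_quarter -/b; set z := b.+1%:R^-1; lra.
- apply: hH; have /ltW/le_trans := hzeta _ _ _ _ zetar _ lm; apply.
  have := hG _ _ close_r; have := cauchy_rate_block (n + l).+1 hxi xib.
  by rewrite invS_half invS_quarter -/b; set z := b.+1%:R^-1; lra.
Qed.

Theorem theorem4p23 (R : realType) (X : metricType R)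
    (G H : {nonneg R} -> {nonneg R})
    (F : set X) (AF : nat -> set X)
    (eps : nat -> {nonneg R})
    (phin : nat -> X -> X -> {nonneg R}) (phi psi : X -> X -> {nonneg R})
    (pi A theta gamma alphaG betaH f : nat -> nat)
    (x : nat -> X)
    (chi zeta : nat -> nat -> nat -> nat)
    (xi kappa delta omega : nat -> nat) (Phi : nat -> nat -> nat)
    (hF0 : F !=set0)
    (hF : F = \bigcap_k AF k)
    (hAF : forall k, AF k.+1 `<=` AF k)
    (heps : summable_errors eps)
    (hpi : upper_rate phin phi pi)
    (hA : forall n, preceq_modulus A psi (phin n))
    (hgamma : total_boundedness_modulus phi gamma)
    (hG : G_modulus G alphaG)
    (hH : H_modulus H betaH)
    (hf_nondec : forall m n, (m <= n)%N -> (f m <= f n)%N)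
    (hf_le : forall n, (f n <= n)%N)
    (hchi : quasi_fejer (fun n => phin (2 * n)%N) G H AF
              (fun n => x (2 * n)%N) eps chi)
    (hxi : cauchy_rate eps xi)
    (hPhi : liminf_bound AF (fun n => x (2 * f n)%N) Phi)
    (hkappa : divergence_rate f kappa)
    (hzeta : quasi_f_monotone phin G H f AF x eps zeta)
    (hclosed : uniformly_closed AF psi delta omega) :
  let Psit := Psi A theta omega alphaG betaH gamma pi xi kappa delta f
                chi zeta Phi in
  (weakly_triangular psi theta ->
    forall (k : nat) (g : nat -> nat),
    exists N : nat, (N <= Psit k g)%N /\
      forall i j : nat, (N <= i <= N + g N)%N -> (N <= j <= N + g N)%N ->
        (psi (x i) (x j))%:num <= k.+1%:R^-1 /\ AF k (x i)) /\
  (triangular psi theta ->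
    forall (k : nat) (g : nat -> nat),
    exists N : nat, (N <= Psit k g)%N /\
      forall i j : nat, (N <= i <= N + g N)%N -> (N <= j <= N + g N)%N ->
        mdist (x i) (x j) <= k.+1%:R^-1 /\ AF k (x i)).
Proof.
move=> Psit.
have tracked k g : exists n (p : X),
    [/\ (2 * n <= Psit k g)%N, AF (delta k) p &
      forall i, (2 * n <= i <= 2 * n + g (2 * n))%N ->
        (psi p (x i))%:num <= (theta_max theta omega k).+1%:R^-1].
  pose c := A (theta_max theta omega k).
  pose r := r_ A theta omega betaH k.
  pose s := s_ A theta omega alphaG betaH k.
  pose K := K_ A theta omega alphaG betaH k.
  pose e n := Defs.eta alphaG betaH delta f chi zeta k g n r.
  have [n [p [khat nPsi pn close]]] := phi_close_approximate_point e
    (k_hat A theta omega alphaG betaH pi xi kappa k) K hgamma hAF hPhi.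
  have AFp a : (a <= e n)%N -> AF a p.
    by move=> an; apply: antitone_approximants pn.
  move: khat; rewrite /k_hat !geq_max => /and4P[ks _ kb kpi].
  (* Passing from phi to phin costs another [(K + 1)^-1], which the factor 2 in
     the definition of [K_] pays for. *)
  have start a : (2 * a + 1 <= K)%N ->
      (phin (2 * f n)%N p (x (2 * f n)%N))%:num <= a.+1%:R^-1.
    move=> aK; have piK : (pi K <= 2 * f n)%N.
      by apply: leq_trans (hkappa _ _ kpi) _; rewrite leq_pmull.
    have := close; have := hpi K _ piK p (x (2 * f n)%N).
    have := @ler_invS R _ _ aK; rewrite invS_half.
    by move: (K.+1%:R^-1) (a.+1%:R^-1) => w z; lra.
  exists n, p; split; first by rewrite leq_mul2l/= Psi0_iter.
    by apply: AFp; rewrite leq_max leqnn.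
  move=> i /andP[ni im]; apply: (hA i).
  apply: (closeness_propagates (m := (g (2 * n) %/ 2)%N) hG hH hchi hzeta hxi
    (hf_le n)).
  - exact: hkappa ks.
  - exact: hkappa kb.
  - by apply: AFp; rewrite /e /Defs.eta !leq_max leqnn !orbT.
  - by apply: AFp; rewrite /e /Defs.eta !leq_max leqnn !orbT.
  - by apply: AFp; rewrite /e /Defs.eta !leq_max leqnn !orbT.
  - by apply: start; rewrite leq_maxl.
  - by apply: start; rewrite leq_maxr.
  - by lia.
(* Both conclusions compare two points of the window through [p]; they differ
   only in the quantity [D] that triangularity bounds. *)
have window (D : X -> X -> R) :
    (forall k y u v, (psi y u)%:num <= (theta k).+1%:R^-1 ->
      (psi y v)%:num <= (theta k).+1%:R^-1 -> D u v <= k.+1%:R^-1) ->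
    forall k g, exists N : nat, (N <= Psit k g)%N /\
      forall i j : nat, (N <= i <= N + g N)%N -> (N <= j <= N + g N)%N ->
        D (x i) (x j) <= k.+1%:R^-1 /\ AF k (x i).
  move=> hD k g; have [n [p [nPsi deltap close]]] := tracked k g.
  have close_theta i : (2 * n <= i <= 2 * n + g (2 * n))%N ->
      (psi p (x i))%:num <= (theta k).+1%:R^-1.
    by move=> /close/le_trans; apply; rewrite ler_invS// leq_maxl.
  exists (2 * n)%N; split=> // i j hi hj; split.
    by apply: hD; exact: close_theta.
  apply: (hclosed _ _ _ deltap); apply: le_trans (close _ hi) _.
  by rewrite ler_invS// leq_maxr.
split=> htri.
- by apply: (window (fun u v => (psi u v)%:num)) => k y u v; exact: htri.
- by apply: (window mdist) => k y u v; exact: htri.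
Qed.
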